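(* Let $\mathcal{V}$ be a variety with a weak difference term, $\mathbf{A}\in\mathcal{V}$, and $\gamma,\theta,\delta,\varepsilon\in\mathrm{Con}(\mathbf{A})$ with $\gamma\prec\theta$, $\delta\prec\varepsilon$, $\theta/\gamma$ and $\varepsilon/\delta$ abelian, and $\theta\wedge\delta=\gamma$, $\theta\vee\delta=\varepsilon$. Let $\alpha=(\gamma:\theta)$. (1) The rule \[(a/\gamma,b/\gamma)/\Delta_{\theta/\gamma,\alpha/\gamma}\mapsto(a/\delta,b/\delta)/\Delta_{\varepsilon/\delta,\alpha/\delta}\quad\text{for }(a,b)\in\theta\] is a well-defined isomorphism $D(\mathbf{A}/\gamma,\theta/\gamma)\cong D(\mathbf{A}/\delta,\varepsilon/\delta)$. (2) $\mathbb{F}_{\theta/\gamma}\cong\mathbb{F}_{\varepsilon/\delta}$.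
   Context: $C(\varphi,\theta;\delta)$ means: for every term $t(\bar x,\bar y)$, all $(a_i,b_i)\in\varphi$, $(c_j,d_j)\in\theta$, if $t(\bar a,\bar c)\equiv_\delta t(\bar a,\bar d)$ then $t(\bar b,\bar c)\equiv_\delta t(\bar b,\bar d)$. $(\delta:\theta)$ is the largest $\varphi$ with $C(\varphi,\theta;\delta)$; $\theta/\delta$ abelian iff $C(\theta,\theta;\delta)$. For $\beta\le\beta'$, $\beta'/\beta$ is the congruence of $\mathbf{A}/\beta$ corresponding to $\beta'$. A weak difference term for $\mathcal{V}$ is an idempotent ternary term $d$ such that in every member, for all congruences $\delta\le\theta$ with $\theta/\delta$ abelian, $d(a,a,b)\equiv_\delta b\equiv_\delta d(b,a,a)$ for $(a,b)\in\theta$. For an algebra $\mathbf{B}$ and congruences $\kappa,\psi$: $\mathbf{B}(\kappa)$ is $\kappa$ as a subalgebra of $\mathbf{B}^2$; $\Delta_{\kappa,\psi}$ is the congruence of $\mathbf{B}(\kappa)$ generated by $\{((a,a),(b,b)):(a,b)\in\psi\}$. For abelian $\kappa$ with $\beta=(0:\kappa)$, the difference algebra is $D(\mathbf{B},\kappa)=\mathbf{B}(\kappa)/\Delta_{\kappa,\beta}$, its derived congruence is $\varphi=\overline{\beta}/\Delta_{\kappa,\beta}$ where $\overline{\beta}=\{((a_1,a_2),(b_1,b_2))\in B(\kappa)^2:(a_1,b_1)\in\beta\}$, and its canonical transversal is $D^o=\{0_E:E\in B/\beta\}$ with $0_E=\{(c,c):c\in E\}$. If moreover $\kappa$ is minimal,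 $\mathbb{F}_\kappa$ is the division ring of endomorphisms $\lambda$ of $D(\mathbf{B},\kappa)$ with $\lambda(\varphi)\subseteq\varphi$ fixing $D^o$ pointwise, with multiplication $\circ$, unit the identity, zero the retraction onto $D^o$ with kernel $\varphi$, and addition $(\lambda+\mu)(x)=d(\lambda(x),0(x),\mu(x))$. Thus $\mathbb{F}_{\theta/\gamma}$ is this ring for $\mathbf{B}=\mathbf{A}/\gamma$, $\kappa=\theta/\gamma$, and similarly for $\varepsilon/\delta$. *)

(* Defs.v *)
From mathcomp Require Import all_boot.
From mathcomp Require Import boolp classical_sets functions.

Set Implicit Arguments.
Unset Strict Implicit.
Unset Printing Implicit Defensive.

Local Open Scope classical_set_scope.

Record signature := Signature { symbol : Type; arity : symbol -> nat }.

Record algebra (S : signature) := Algebra {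
  carrier :> Type;
  op : forall f : symbol S, ('I_(arity f) -> carrier) -> carrier }.

Arguments op {S a} f _.

Inductive term (S : signature) (X : Type) : Type :=
| Var of X
| App (f : symbol S) of ('I_(arity f) -> term S X).

Arguments Var {S X} _.
Arguments App {S X} f _.

Fixpoint eval (S : signature) (A : algebra S) (X : Type) (v : X -> A)
    (t : term S X) : A :=
  match t with
  | Var x => v x
  | App f ts => op f (fun i => eval v (ts i))
  end.

Fixpoint subst (S : signature) (X Y : Type) (s : X -> term S Y)
    (t : term S X) : term S Y :=
  match t with
  | Var x => s x
  | App f ts => App f (fun i => subst s (ts i))
  end.

Lemma eval_subst (S : signature) (A : algebra S) (X Y : Type)
    (s : X -> term S Y) (v : Y -> A) (t : term S X) :
  eval v (subst s t) = eval (fun x => eval v (s x)) t.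
Proof.
by elim: t => //= f ts IH; congr (op f _); apply/funext => i; apply: IH.
Qed.

Definition eval3 (S : signature) (A : algebra S) (d : term S 'I_3)
    (x y z : A) : A :=
  eval (tnth [tuple x; y; z]) d.

(** The valuation of a term [t(x,y)] in two blocks of variables. *)
Definition blocks (T X Y : Type) (a : X -> T) (c : Y -> T) (v : X + Y) : T :=
  match v with inl i => a i | inr j => c j end.

Definition satisfies (S : signature) (A : algebra S)
    (e : term S nat * term S nat) : Prop :=
  forall v : nat -> A, eval v e.1 = eval v e.2.

Definition variety (S : signature) (V : algebra S -> Prop) : Prop :=
  exists Sigma : term S nat * term S nat -> Prop,
    forall A : algebra S, V A <-> forall e, Sigma e -> satisfies A e.

Definition is_hom (S : signature) (A B : algebra S) (h : A -> B) : Prop :=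
  forall (f : symbol S) (x : 'I_(arity f) -> A),
    h (op f x) = op f (fun i => h (x i)).

Definition isomorphism (S : signature) (A B : algebra S) (h : A -> B) : Prop :=
  is_hom h /\ bijective h.

Record con (S : signature) (A : algebra S) := Con {
  con_rel :> A -> A -> Prop;
  con_refl : forall x, con_rel x x;
  con_sym : forall x y, con_rel x y -> con_rel y x;
  con_trans : forall x y z, con_rel x y -> con_rel y z -> con_rel x z;
  con_op : forall (f : symbol S) (x y : 'I_(arity f) -> A),
    (forall i, con_rel (x i) (y i)) -> con_rel (op f x) (op f y) }.

Lemma con_eq (S : signature) (A : algebra S) (theta psi : con A) :
  (forall x y, theta x y <-> psi x y) -> theta = psi.
Proof.
case: theta psi => [R a b c e] [R' a' b' c' e'] /= RR'.
have RE : R = R' by apply/funext => x; apply/funext => y; apply/propext.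
case: R' / RE a' b' c' e' {RR'} => a' b' c' e'.
by congr Con; apply: Prop_irrelevance.
Qed.

Definition con_le (S : signature) (A : algebra S) (theta psi : con A) : Prop :=
  forall x y, theta x y -> psi x y.

Definition con_lt (S : signature) (A : algebra S) (theta psi : con A) : Prop :=
  con_le theta psi /\ theta <> psi.

Definition covers (S : signature) (A : algebra S) (theta psi : con A) : Prop :=
  con_lt theta psi /\ ~ exists chi, con_lt theta chi /\ con_lt chi psi.

Program Definition con0 (S : signature) (A : algebra S) : con A :=
  @Con S A eq _ _ _ _.
Next Obligation. by congr (op f _); apply/funext. Qed.

Program Definition con_meet (S : signature) (A : algebra S)
    (theta psi : con A) : con A :=
  @Con S A (fun x y => theta x y /\ psi x y) _ _ _ _.
Next Obligation. by split; apply: con_refl. Qed.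
Next Obligation. by split; apply: con_sym. Qed.
Next Obligation. by split; [apply: (con_trans H)|apply: (con_trans H2)]. Qed.
Next Obligation. by split; apply: con_op => i; case: (H i). Qed.

Program Definition Cg (S : signature) (A : algebra S)
    (R : A -> A -> Prop) : con A :=
  @Con S A (fun x y => forall psi : con A,
    (forall u v, R u v -> psi u v) -> psi x y) _ _ _ _.
Next Obligation. exact: con_refl. Qed.
Next Obligation. by apply: con_sym; apply: H. Qed.
Next Obligation. by apply: (con_trans (H _ H1)); apply: H0. Qed.
Next Obligation. by apply: con_op => i; apply: H. Qed.

Definition con_join (S : signature) (A : algebra S)
    (theta psi : con A) : con A :=
  Cg (fun x y => theta x y \/ psi x y).

Program Definition con_preim (S : signature) (A B : algebra S) (h : A -> B)
    (hh : is_hom h) (theta : con B) : con A :=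
  @Con S A (fun x y => theta (h x) (h y)) _ _ _ _.
Next Obligation. exact: con_refl. Qed.
Next Obligation. exact: con_sym. Qed.
Next Obligation. exact: con_trans H H0. Qed.
Next Obligation. by rewrite !hh; apply: con_op. Qed.

(** The elements of [A/theta] are the [theta]-classes, as sets. *)

Definition class_set (S : signature) (A : algebra S) (theta : con A) (a : A) :
  set A := [set x | theta a x].

Definition quot_carrier (S : signature) (A : algebra S) (theta : con A) : Type :=
  {E : set A | exists a, E = class_set theta a}.

Definition quot_repr (S : signature) (A : algebra S) (theta : con A)
    (E : quot_carrier theta) : A := sval (cid (svalP E)).

Definition quot_class (S : signature) (A : algebra S) (theta : con A) (a : A) :
    quot_carrier theta :=
  exist _ (class_set theta a) (ex_intro _ a erefl).

Definition quot (S : signature) (A : algebra S) (theta : con A) : algebra S :=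
  @Algebra S (quot_carrier theta)
    (fun f E => quot_class theta (op f (fun i => quot_repr (E i)))).

Definition proj (S : signature) (A : algebra S) (theta : con A) (a : A) :
  quot theta := quot_class theta a.

Lemma projP (S : signature) (A : algebra S) (theta : con A) (a b : A) :
  proj theta a = proj theta b <-> theta a b.
Proof.
split=> [/(congr1 sval) /= ab|ab].
  by have : class_set theta b b by [apply: con_refl]; rewrite -ab.
apply: eq_exist; apply/funext => x; apply/propext; split => h.
  exact: con_trans (con_sym ab) h.
exact: con_trans ab h.
Qed.

Lemma quot_reprK (S : signature) (A : algebra S) (theta : con A)
    (E : quot theta) : proj theta (quot_repr E) = E.
Proof.
case: E => E' hE; apply: eq_exist; rewrite /quot_repr.
by case: (cid _) => a /= ->.
Qed.

Lemma proj_hom (S : signature) (A : algebra S) (theta : con A) :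
  is_hom (proj theta).
Proof.
move=> f x; apply/projP; apply: con_op => i.
by apply/projP; rewrite quot_reprK.
Qed.

(** [psi/theta]: generating a congruence makes this total in [theta] and [psi];
    [quot_conE] gives its elements when [theta <= psi]. *)
Definition quot_con (S : signature) (A : algebra S) (theta psi : con A) :
    con (quot theta) :=
  Cg (fun X Y => exists x y, [/\ psi x y, X = proj theta x & Y = proj theta y]).

Lemma quot_conE (S : signature) (A : algebra S) (theta psi : con A) :
  con_le theta psi ->
  forall x y, quot_con theta psi (proj theta x) (proj theta y) <-> psi x y.
Proof.
move=> le x y; split; last first.
  by move=> xy chi; apply; exists x, y.
have reprE z : psi (quot_repr (proj theta z)) z.
  by apply: le; apply/projP; rewrite quot_reprK.
have qop (f : symbol S) (X : 'I_(arity f) -> quot theta) :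
    psi (quot_repr (op f X)) (op f (fun i => quot_repr (X i))) by exact: reprE.
pose R := fun X Y : quot theta => psi (quot_repr X) (quot_repr Y).
have Rop f (X Y : 'I_(arity f) -> quot theta) :
    (forall i, R (X i) (Y i)) -> R (op f X) (op f Y).
  move=> XY; apply: con_trans (qop _ _) _.
  apply: con_trans (con_sym (qop _ _)).
  exact: con_op.
pose chi := @Con S (quot theta) R (fun _ => con_refl _ _)
  (fun _ _ => @con_sym _ _ _ _ _) (fun _ _ _ => @con_trans _ _ _ _ _ _) Rop.
move/(_ chi) => h.
have {h} : R (proj theta x) (proj theta y).
  apply: h => _ _ [u [v [uv -> ->]]]; rewrite /= /R.
  exact: con_trans (reprE u) (con_trans uv (con_sym (reprE v))).
move=> xy; exact: con_trans (con_sym (reprE x)) (con_trans xy (reprE y)).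
Qed.

Definition centralizes (S : signature) (A : algebra S)
    (phi theta delta : con A) : Prop :=
  forall (m n : nat) (t : term S ('I_m + 'I_n))
    (a b : 'I_m -> A) (c d : 'I_n -> A),
    (forall i, phi (a i) (b i)) -> (forall j, theta (c j) (d j)) ->
    delta (eval (blocks a c) t) (eval (blocks a d) t) ->
    delta (eval (blocks b c) t) (eval (blocks b d) t).

(** [(delta : theta)], as the join of the [phi] with [C(phi,theta;delta)];
    [residual_largest] shows that it is the largest of them. *)
Definition residual (S : signature) (A : algebra S) (delta theta : con A) :
    con A :=
  Cg (fun x y => exists phi : con A, centralizes phi theta delta /\ phi x y).

Section ResidualLargest.
Variables (S : signature) (A : algebra S) (delta theta : con A).

Let test m n (t : term S ('I_m + 'I_n)) (a : 'I_m -> A) (c d : 'I_n -> A) :=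
  delta (eval (blocks a c) t) (eval (blocks a d) t).

Let R (a b : A) : Prop := forall n (t : term S ('I_1 + 'I_n)) (c d : 'I_n -> A),
  (forall j, theta (c j) (d j)) ->
  test t (fun=> a) c d <-> test t (fun=> b) c d.

Let test_step m n (t : term S ('I_m + 'I_n)) (a b : 'I_m -> A) c d (k : 'I_m) :
  (forall i, i != k -> a i = b i) -> R (a k) (b k) ->
  (forall j, theta (c j) (d j)) ->
  test t a c d <-> test t b c d.
Proof.
move=> ab Rk cd.
pose s (v : 'I_m + 'I_n) : term S ('I_1 + 'I_(n + m)) := match v with
  | inl i => if i == k then Var (inl ord0) else Var (inr (rshift n i))
  | inr j => Var (inr (lshift m j)) end.
pose ext (x : 'I_n -> A) (v : 'I_(n + m)) :=
  match fintype.split v with inl j => x j | inr i => a i end.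
have extl x j : ext x (lshift m j) = x j.
  by rewrite /ext; case: split_ordP => [j' /lshift_inj ->|i /eqP] //; rewrite eq_lrshift.
have extr x i : ext x (rshift n i) = a i.
  by rewrite /ext; case: split_ordP => [j' /eqP|i' /rshift_inj ->] //; rewrite eq_rlshift.
have E (u : A) (a' : 'I_m -> A) x : (forall i, i != k -> a i = a' i) -> a' k = u ->
    eval (blocks (fun _ : 'I_1 => u) (ext x)) (subst s t) = eval (blocks a' x) t.
  move=> aa' a'k; rewrite eval_subst; congr (eval _ t).
  apply/funext => -[i|j] /=; last by rewrite extl.
  by case: eqVneq => [->|ik] //=; rewrite extr aa'.
have cd' j : theta (ext c j) (ext d j).
  by rewrite /ext; case: (fintype.split j) => // i; apply: con_refl.
have := Rk _ (subst s t) _ _ cd'.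
by rewrite /test !(E (a k) a) // !(E (b k) b).
Qed.

Let test_all m n (t : term S ('I_m + 'I_n)) a b c d :
  (forall i, R (a i) (b i)) -> (forall j, theta (c j) (d j)) ->
  test t a c d <-> test t b c d.
Proof.
move=> ab cd.
pose z k (i : 'I_m) := if i < k then b i else a i.
suff H k : k <= m -> test t a c d <-> test t (z k) c d.
  have -> : b = z m by apply/funext => i; rewrite /z ltn_ord.
  exact: H.
elim: k => [//|k IH] km.
apply: (iff_trans (IH (ltnW km))); apply: (@test_step _ _ _ _ _ _ _ (Ordinal km)) => //.
- move=> i ik; rewrite /z ltnS (leq_eqVlt i k).
  have nik : nat_of_ord i != k.
    by apply: contraNneq ik => ik; apply/eqP/val_inj.
  by rewrite (negbTE nik).
- by rewrite /z /= ltnn ltnSn.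
Qed.

Let Rrefl x : R x x. Proof. by []. Qed.
Let Rsym x y : R x y -> R y x.
Proof. by move=> xy n t c d cd; rewrite (xy n t c d cd). Qed.
Let Rtrans x y z : R x y -> R y z -> R x z.
Proof. by move=> xy yz n t c d cd; rewrite (xy n t c d cd) (yz n t c d cd). Qed.
Let Rop f (x y : 'I_(arity f) -> A) : (forall i, R (x i) (y i)) ->
  R (op f x) (op f y).
Proof.
move=> xy n t c d cd.
pose s (v : 'I_1 + 'I_n) : term S ('I_(arity f) + 'I_n) := match v with
  | inl _ => App f (fun i => Var (inl i)) | inr j => Var (inr j) end.
have E u e : eval (blocks u e) (subst s t) = eval (blocks (fun=> op f u) e) t.
  by rewrite eval_subst; congr (eval _ t); apply/funext => -[].
by have := test_all (subst s t) xy cd; rewrite /test !E.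
Qed.

Let Rcon : con A := Con Rrefl Rsym Rtrans Rop.

Lemma residual_largest :
  centralizes (residual delta theta) theta delta /\
  forall phi, centralizes phi theta delta -> con_le phi (residual delta theta).
Proof.
split; last by move=> phi Cphi x y xy psi; apply; exists phi.
have le : con_le (residual delta theta) Rcon.
  move=> x y /(_ Rcon); apply=> u v [phi [Cphi uv]] n t c d cd.
  by split; apply: Cphi => // _; apply: con_sym.
by move=> m n t a b c d ab cd; apply: (test_all t _ cd).1 => i; apply: le.
Qed.

End ResidualLargest.

Definition abelian (S : signature) (A : algebra S) (theta delta : con A) : Prop :=
  centralizes theta theta delta.

Definition weak_difference_term (S : signature) (V : algebra S -> Prop)
    (d : term S 'I_3) : Prop :=
  (forall A : algebra S, V A -> forall x : A, eval3 d x x x = x) /\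
  (forall A : algebra S, V A -> forall delta theta : con A,
     con_le delta theta -> abelian theta delta ->
     forall a b : A, theta a b ->
       delta (eval3 d a a b) b /\ delta b (eval3 d b a a)).

Definition square (S : signature) (B : algebra S) : algebra S :=
  @Algebra S (B * B)%type
    (fun f x => (op f (fun i => (x i).1), op f (fun i => (x i).2))).

Definition subuniverse (S : signature) (B : algebra S) (U : set B) : Prop :=
  forall (f : symbol S) (x : 'I_(arity f) -> B), (forall i, U (x i)) -> U (op f x).

Definition subalgebra (S : signature) (B : algebra S) (U : set B)
    (hU : subuniverse U) : algebra S :=
  @Algebra S {x : B | U x}
    (fun f x => exist _ (op f (fun i => sval (x i))) (hU f _ (fun i => svalP (x i)))).

Lemma con_subuniverse (S : signature) (B : algebra S) (kappa : con B) :
  @subuniverse S (square B) [set p | kappa p.1 p.2].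
Proof. by move=> f x h; apply: con_op. Qed.

(** [B(kappa)], a subalgebra of the square of [B]. *)
Definition pair_alg (S : signature) (B : algebra S) (kappa : con B) : algebra S :=
  subalgebra (@con_subuniverse S B kappa).

Definition pair_val (S : signature) (B : algebra S) (kappa : con B)
    (p : pair_alg kappa) : B * B := sval p.

Definition Delta (S : signature) (B : algebra S) (kappa psi : con B) :
    con (pair_alg kappa) :=
  Cg (fun p q => exists a b : B,
        [/\ psi a b, pair_val p = (a, a) & pair_val q = (b, b)]).

Definition annihilator (S : signature) (B : algebra S) (kappa : con B) : con B :=
  residual (con0 B) kappa.

Definition diff_alg (S : signature) (B : algebra S) (kappa : con B) : algebra S :=
  quot (Delta kappa (annihilator kappa)).

(** The class [(u,v)/Delta_(kappa,psi)] as a set of pairs; it is empty when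
    [(u,v)] is not in [kappa]. *)
Definition pair_class (S : signature) (B : algebra S) (kappa psi : con B)
    (u v : B) : set (pair_alg kappa) :=
  [set p | exists q : pair_alg kappa, pair_val q = (u, v) /\ Delta kappa psi q p].

Arguments pair_class {S B} kappa psi u v _.

Lemma fst_hom (S : signature) (B : algebra S) (kappa : con B) :
  @is_hom S (pair_alg kappa) B (fun p => (pair_val p).1).
Proof. by []. Qed.

Definition bar_con (S : signature) (B : algebra S) (kappa beta : con B) :
    con (pair_alg kappa) :=
  con_preim (fst_hom (kappa := kappa)) beta.

Lemma Delta_le_bar (S : signature) (B : algebra S) (kappa psi : con B) :
  con_le (Delta kappa psi) (bar_con kappa psi).
Proof.
move=> p q /(_ (bar_con kappa psi)); apply=> u v [a [b [ab ua vb]]].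
by rewrite /= ua vb.
Qed.

Definition derived_con (S : signature) (B : algebra S) (kappa : con B) :
    con (diff_alg kappa) :=
  quot_con (Delta kappa (annihilator kappa)) (bar_con kappa (annihilator kappa)).

(** The set [0_E]. *)
Definition zero_set (S : signature) (B : algebra S) (kappa : con B)
    (E : quot (annihilator kappa)) : set (pair_alg kappa) :=
  [set p | exists2 c, sval E c & pair_val p = (c, c)].

Definition transversal (S : signature) (B : algebra S) (kappa : con B) :
    set (diff_alg kappa) :=
  [set x | exists E, sval x = zero_set E].

Arguments transversal {S B} kappa _.


Definition retraction (S : signature) (D : algebra S) (T : set D) (phi : con D)
    (r : D -> D) : Prop :=
  [/\ is_hom r, range r = T, (forall x, T x -> r x = x)
    & forall x y, r x = r y <-> phi x y].

Lemma retraction_unique (S : signature) (D : algebra S) (T : set D) (phi : con D)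
    (r r' : D -> D) :
  retraction T phi r -> retraction T phi r' -> r = r'.
Proof.
move=> [_ rT rid rk] [_ _ r'id r'k]; apply/funext => x.
have Trx : T (r x) by rewrite -rT; exists x.
by rewrite -(r'id _ Trx); apply/r'k/rk; apply: rid.
Qed.

(** The division ring [F_kappa] is the set [F_set kappa] of self-maps of
    [diff_alg kappa] with the operations below. These are defined on all
    self-maps; [F_set kappa] is closed under them when [kappa] is minimal and
    abelian and [d] is a weak difference term for the ambient variety. *)
Definition F_set (S : signature) (B : algebra S) (kappa : con B) :
    set (diff_alg kappa -> diff_alg kappa) :=
  [set l | [/\ is_hom l,
      forall x y, derived_con kappa x y -> derived_con kappa (l x) (l y)
    & forall x, transversal kappa x -> l x = x]].

Arguments F_set {S B} kappa _.

(** The retraction onto the transversal with kernel [derived_con kappa]; it is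
    unique by [retraction_unique]. *)
Definition F_zero (S : signature) (B : algebra S) (kappa : con B) :
    diff_alg kappa -> diff_alg kappa :=
  @xget {classic (diff_alg kappa -> diff_alg kappa)} idfun
    [set r | retraction (transversal kappa) (derived_con kappa) r].

Arguments F_zero {S B} kappa _.

Definition F_one (S : signature) (B : algebra S) (kappa : con B) :
  diff_alg kappa -> diff_alg kappa := idfun.

Arguments F_one {S B} kappa _.

Definition F_add (S : signature) (d : term S 'I_3) (B : algebra S) (kappa : con B)
    (l m : diff_alg kappa -> diff_alg kappa) : diff_alg kappa -> diff_alg kappa :=
  fun x => eval3 d (l x) (F_zero kappa x) (m x).

Definition F_mul (S : signature) (B : algebra S) (kappa : con B)
    (l m : diff_alg kappa -> diff_alg kappa) : diff_alg kappa -> diff_alg kappa :=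
  l \o m.

Definition F_isomorphic (S : signature) (d : term S 'I_3) (B B' : algebra S)
    (kappa : con B) (kappa' : con B') : Prop :=
  exists Phi : (diff_alg kappa -> diff_alg kappa) ->
               (diff_alg kappa' -> diff_alg kappa'),
    [/\ set_bij (F_set kappa) (F_set kappa') Phi,
        Phi (F_zero kappa) = F_zero kappa',
        Phi (F_one kappa) = F_one kappa',
        forall l m, F_set kappa l -> F_set kappa m ->
          Phi (F_add d l m) = F_add d (Phi l) (Phi m)
      & forall l m, F_set kappa l -> F_set kappa m ->
          Phi (F_mul l m) = F_mul (Phi l) (Phi m)].

(* Main.v *)
(**
The weak difference term gives epsilon = delta o theta o delta, hence
(gamma : theta) = (delta : epsilon) = alpha, and (a,b) |-> (a/delta, b/delta)
maps A(theta) onto the pairs of epsilon/delta. With kappa = theta/gamma, let K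
be the kernel of the induced map from kappa to D(A/delta, epsilon/delta). It
lies between Delta = Delta_(kappa, alpha/gamma) and the lift bar of
alpha/gamma, and it has no diagonal pair related to a non-diagonal one, because
theta /\ delta = gamma. Such a congruence must equal Delta, since bar/Delta is
abelian and d is therefore Mal'cev on the bar-classes modulo Delta.

The isomorphism respects the derived congruences and the transversals, so that
conjugation by it is the isomorphism of (2). The zero and the sum are carried
over because the retraction is determined by these data.
*)
Require Import Defs.
From mathcomp Require Import all_boot.
From mathcomp Require Import boolp classical_sets functions.

Set Implicit Arguments.
Unset Strict Implicit.
Unset Printing Implicit Defensive.

Local Open Scope classical_set_scope.

(** * Homomorphisms, term evaluation and the pair algebra *)

Lemma hom_eval (S : signature) (A B : algebra S) (h : A -> B) (X : Type)
    (v : X -> A) (t : term S X) :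
  is_hom h -> h (eval v t) = eval (h \o v) t.
Proof.
move=> hh; elim: t => //= f ts IH; rewrite hh.
by congr (op f _); apply/funext => i; apply: IH.
Qed.

Lemma con_eval (S : signature) (A : algebra S) (theta : con A) (X : Type)
    (v w : X -> A) (t : term S X) :
  (forall x, theta (v x) (w x)) -> theta (eval v t) (eval w t).
Proof. by move=> vw; elim: t => //= f ts IH; apply: con_op. Qed.

Lemma hom_blocks (S : signature) (A B : algebra S) (h : A -> B) (X Y : Type)
    (a : X -> A) (c : Y -> A) (t : term S (X + Y)) :
  is_hom h -> h (eval (blocks a c) t) = eval (blocks (h \o a) (h \o c)) t.
Proof.
move=> hh; rewrite hom_eval //; congr (eval _ t).
by apply/funext => -[].
Qed.

Lemma eval3_hom (S : signature) (A B : algebra S) (h : A -> B)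
    (d : term S 'I_3) (x y z : A) :
  is_hom h -> h (eval3 d x y z) = eval3 d (h x) (h y) (h z).
Proof.
move=> hh; rewrite /eval3 hom_eval //; congr (eval _ d).
by apply/funext => -[[|[|[|i]]] hi].
Qed.

Lemma eval3_con (S : signature) (A : algebra S) (theta : con A)
    (d : term S 'I_3) (x y z x' y' z' : A) :
  theta x x' -> theta y y' -> theta z z' ->
  theta (eval3 d x y z) (eval3 d x' y' z').
Proof. by move=> hx hy hz; apply: con_eval => -[[|[|[|i]]] //= hi]. Qed.

Lemma variety_surj (S : signature) (V : algebra S -> Prop) (A B : algebra S)
    (h : A -> B) :
  variety V -> is_hom h -> (forall b, exists a, h a = b) -> V A -> V B.
Proof.
move=> [Sigma VE] hh hsurj /VE VA; apply/VE => e /VA sat v.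
have /choice [w hw] n : exists a, h a = v n by exact: hsurj.
have -> : v = h \o w by apply/funext => n /=.
by rewrite -!hom_eval // sat.
Qed.

Lemma snd_hom (S : signature) (B : algebra S) (kappa : con B) :
  @is_hom S (pair_alg kappa) B (fun p => (pair_val p).2).
Proof. by []. Qed.

Definition mkpair (S : signature) (B : algebra S) (kappa : con B) (a b : B)
  (ab : kappa a b) : pair_alg kappa := exist _ (a, b) ab.

Lemma pair_alg_eq (S : signature) (B : algebra S) (kappa : con B)
    (p q : pair_alg kappa) :
  (pair_val p).1 = (pair_val q).1 -> (pair_val p).2 = (pair_val q).2 -> p = q.
Proof. by case: p q => [[a b] p] [[a' b'] q] /= aa bb; apply: eq_exist; rewrite aa bb. Qed.

Lemma variety_pair_alg (S : signature) (V : algebra S -> Prop) (B : algebra S)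
    (kappa : con B) :
  variety V -> V B -> V (pair_alg kappa).
Proof.
move=> [Sigma VE] /VE VB; apply/VE => e /VB sat v.
apply: pair_alg_eq.
  by rewrite !(hom_eval _ _ (fst_hom (kappa := kappa))) sat.
by rewrite !(hom_eval _ _ (snd_hom (kappa := kappa))) sat.
Qed.

(** * The term condition *)

(** Enumerating the variables lets later arguments index the two blocks by [unit], [bool] or a sum
    instead of ordinals. *)
Lemma centralizes_fin (S : signature) (A : algebra S) (phi theta delta : con A)
    (X Y : finType) (t : term S (X + Y)) (a b : X -> A) (c d : Y -> A) :
  centralizes phi theta delta ->
  (forall i, phi (a i) (b i)) -> (forall j, theta (c j) (d j)) ->
  delta (eval (blocks a c) t) (eval (blocks a d) t) ->
  delta (eval (blocks b c) t) (eval (blocks b d) t).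
Proof.
move=> C ab cd.
pose s (v : X + Y) : term S ('I_#|X| + 'I_#|Y|) := match v with
  | inl i => Var (inl (enum_rank i)) | inr j => Var (inr (enum_rank j)) end.
have E (x : X -> A) (y : Y -> A) : eval (blocks x y) t =
    eval (blocks (x \o enum_val) (y \o enum_val)) (subst s t).
  rewrite eval_subst; congr (eval _ t).
  by apply/funext => -[i|j] /=; rewrite enum_rankK.
by rewrite !E; apply: C => i /=.
Qed.

Lemma le_residual (S : signature) (A : algebra S) (phi theta delta : con A) :
  con_le phi (residual delta theta) <-> centralizes phi theta delta.
Proof.
have [C lr] := residual_largest delta theta; split; last exact: lr.
move=> le m n t a b c d ab cd; apply: C => // i; exact: le.
Qed.

Lemma centralizes_le (S : signature) (A : algebra S) (phi theta delta : con A) :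
  con_le phi delta -> centralizes phi theta delta.
Proof.
move=> le m n t a b c d ab cd h.
have E e : delta (eval (blocks a e) t) (eval (blocks b e) t).
  by apply: con_eval => -[i|j] /=; [apply: le|apply: con_refl].
exact: con_trans (con_sym (E c)) (con_trans h (E d)).
Qed.

(** The two values compared by the term condition are always [theta]-related, so only the
    restriction of [delta] to [theta] matters. *)
Lemma centralizes_meet (S : signature) (A : algebra S)
    (phi theta delta delta' : con A) :
  (forall x y, theta x y -> delta x y <-> delta' x y) ->
  centralizes phi theta delta -> centralizes phi theta delta'.
Proof.
move=> dd C m n t a b c d ab cd.
have E e : theta (eval (blocks e c) t) (eval (blocks e d) t).
  by apply: con_eval => -[i|j] //=; apply: con_refl.
by move/(dd _ _ (E a)) => h; apply/(dd _ _ (E b)); apply: C h.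
Qed.

(** Moving the [theta']-tuples along [delta] changes the values of [t] only within [delta], so
    centralizing [theta] extends to delta o theta o delta. *)
Lemma centralizes_compose (S : signature) (A : algebra S)
    (phi theta theta' delta : con A) :
  (forall c d, theta' c d ->
     exists c' d', [/\ delta c c', theta c' d' & delta d' d]) ->
  centralizes phi theta delta -> centralizes phi theta' delta.
Proof.
move=> split_theta' C m n t a b c d ab cd h.
have /choice [cd' hcd'] j : exists p : A * A,
    [/\ delta (c j) p.1, theta p.1 p.2 & delta p.2 (d j)].
  by have [c' [d' ?]] := split_theta' _ _ (cd j); exists (c', d').
pose c' j := (cd' j).1; pose d' j := (cd' j).2.
have Ec e : delta (eval (blocks e c) t) (eval (blocks e c') t).
  by apply: con_eval => -[i|j] /=; [apply: con_refl|case: (hcd' j)].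
have Ed e : delta (eval (blocks e d') t) (eval (blocks e d) t).
  by apply: con_eval => -[i|j] /=; [apply: con_refl|case: (hcd' j)].
apply: con_trans (Ec b) (con_trans _ (Ed b)).
apply: C ab _ _; first by move=> j; case: (hcd' j).
exact: con_trans (con_sym (Ec a)) (con_trans h (con_sym (Ed a))).
Qed.

Lemma centralizes_preim (S : signature) (A B : algebra S) (h : A -> B)
    (hh : is_hom h) (phi theta delta : con B) :
  (forall b, exists a, h a = b) ->
  centralizes (con_preim hh phi) (con_preim hh theta) (con_preim hh delta) <->
  centralizes phi theta delta.
Proof.
move=> hsurj; split=> C m n t a b c d ab cd; last first.
  by rewrite /= !hom_blocks //; apply: C.
have lift k (v : 'I_k -> B) : exists w, v = h \o w.
  by have /choice [w hw] i := hsurj (v i); exists w; apply/funext => i /=.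
have [a' aE] := lift _ a; have [b' bE] := lift _ b.
have [c' cE] := lift _ c; have [d' dE] := lift _ d.
subst a b c d; rewrite -!hom_blocks //; exact: C.
Qed.

(** * Annihilators in quotient algebras *)

Lemma proj_surj (S : signature) (A : algebra S) (theta : con A)
    (E : quot theta) : exists a, proj theta a = E.
Proof. by exists (quot_repr E); apply: quot_reprK. Qed.

Lemma quot_eq (S : signature) (A : algebra S) (theta : con A)
    (E F : quot theta) : sval E = sval F -> E = F.
Proof. by case: E F => [E hE] [F hF] /= EF; apply: eq_exist. Qed.

Lemma preim_quot_con (S : signature) (A : algebra S) (gamma theta : con A) :
  con_le gamma theta ->
  con_preim (proj_hom gamma) (quot_con gamma theta) = theta.
Proof. by move=> le; apply: con_eq => x y /=; apply: quot_conE. Qed.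

Lemma preim_proj_con0 (S : signature) (A : algebra S) (gamma : con A) :
  con_preim (proj_hom gamma) (con0 (quot gamma)) = gamma.
Proof. by apply: con_eq => x y /=; apply: projP. Qed.

Lemma centralizes_quot (S : signature) (A : algebra S) (gamma theta : con A)
    (phi : con (quot gamma)) :
  con_le gamma theta ->
  centralizes (con_preim (proj_hom gamma) phi) theta gamma <->
  centralizes phi (quot_con gamma theta) (con0 (quot gamma)).
Proof.
move=> le; rewrite -(centralizes_preim (proj_hom gamma)); last exact: proj_surj.
by rewrite preim_proj_con0 preim_quot_con.
Qed.

(** Both sides are largest for conditions that correspond under preimage along [proj gamma]; the
    residual lies above [gamma], so its quotient loses nothing. *)
Lemma annihilator_quot (S : signature) (A : algebra S) (gamma theta : con A) :
  con_le gamma theta ->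
  annihilator (quot_con gamma theta) = quot_con gamma (residual gamma theta).
Proof.
move=> le.
have gr : con_le gamma (residual gamma theta).
  by apply/le_residual/centralizes_le.
apply: con_eq => X Y; split.
  have [x <-] := proj_surj X; have [y <-] := proj_surj Y.
  move=> xy; apply/(quot_conE gr).
  have : con_le (con_preim (proj_hom gamma) (annihilator (quot_con gamma theta)))
     (residual gamma theta).
    by apply/le_residual/centralizes_quot/le_residual.
  exact.
move: X Y; apply/le_residual/centralizes_quot => //.
by rewrite preim_quot_con //; apply/le_residual.
Qed.

(** * The congruence Delta *)

(* Elements that no unary polynomial separates with respect to [D] form the
   largest congruence for which [D] is a union of classes. *)
Lemma Cg_saturated (S : signature) (P : algebra S) (R : P -> P -> Prop)
    (D : set P) :
  (forall (Y : finType) (t : term S (unit + Y)) (r : Y -> P) p q, R p q ->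
     D (eval (blocks (fun=> p) r) t) <-> D (eval (blocks (fun=> q) r) t)) ->
  forall p q, Cg R p q -> D p <-> D q.
Proof.
move=> RD.
pose M (p q : P) := forall (Y : finType) (t : term S (unit + Y)) (r : Y -> P),
  D (eval (blocks (fun=> p) r) t) <-> D (eval (blocks (fun=> q) r) t).
have Mrefl p : M p p by [].
have Msym p q : M p q -> M q p by move=> pq Y t r; rewrite (pq Y t r).
have Mtrans p q s : M p q -> M q s -> M p s.
  by move=> pq qs Y t r; rewrite (pq Y t r) (qs Y t r).
have Mstep (f : symbol S) (x y : 'I_(arity f) -> P) k :
    (forall i, i != k -> x i = y i) -> M (x k) (y k) -> M (op f x) (op f y).
  move=> xy Mk Y t r.
  (* Only argument [k] of [f] remains the tested variable; the common values of the other arguments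
     join the parameters. *)
  pose s (v : unit + Y) : term S (unit + (Y + 'I_(arity f))) := match v with
    | inl _ => App f (fun i => if i == k then Var (inl tt) else Var (inr (inr i)))
    | inr j => Var (inr (inl j)) end.
  pose r' v := match v with inl j => r j | inr i => x i end.
  have E z : (forall i, i != k -> x i = z i) ->
      eval (blocks (fun=> op f z) r) t =
      eval (blocks (fun=> z k) r') (subst s t).
    move=> xz; rewrite eval_subst; congr (eval _ t).
    apply/funext => -[_|j] //=; congr (op f _); apply/funext => i.
    by case: eqVneq => [->|/xz] /=.
  by rewrite (E x) // (E y).
have Mop (f : symbol S) (x y : 'I_(arity f) -> P) :
    (forall i, M (x i) (y i)) -> M (op f x) (op f y).
  (* In [z k] the first [k] arguments are already replaced, so consecutive tuples differ in one
     place. *)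
  move=> xy; pose z k (i : 'I_(arity f)) := if i < k then y i else x i.
  suff H k : k <= arity f -> M (op f x) (op f (z k)).
    have -> : y = z (arity f) by apply/funext => i; rewrite /z ltn_ord.
    exact: H.
  elim: k => [|k IH] km; first exact: Mrefl.
  apply: (Mtrans _ _ _ (IH (ltnW km))); apply: (Mstep _ _ _ (Ordinal km)).
    move=> i ik; have /negbTE nik : (i : nat) != k by rewrite -val_eqE in ik.
    by rewrite /z ltnS (leq_eqVlt i k) nik.
  by rewrite /z /= ltnn ltnSn.
move=> p q /(_ (Con Mrefl Msym Mtrans Mop)) pq.
have /pq : forall u v, R u v -> Con Mrefl Msym Mtrans Mop u v.
  by move=> u v uv Y t r; apply: RD.
(* The bare variable, without parameters, tests [p] and [q] themselves. *)
by move=> /(_ void (Var (inl tt)) (fun v => match v with end)).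
Qed.

(** A polynomial value at (a,a) is diagonal iff t(a,r1) = t(a,r2), where r1 and r2 are the
    [kappa]-related coordinates of the parameters. The term condition C(psi,kappa;0) carries this
    equality from a to b. *)
Lemma Delta_diag (S : signature) (B : algebra S) (kappa psi : con B)
    (p q : pair_alg kappa) :
  con_le psi (annihilator kappa) -> Delta kappa psi p q ->
  (pair_val p).1 = (pair_val p).2 -> (pair_val q).1 = (pair_val q).2.
Proof.
move=> /le_residual C pq.
suff [] : (pair_val p).1 = (pair_val p).2 <-> (pair_val q).1 = (pair_val q).2 by [].
move: p q pq; apply: (Cg_saturated (D := [set p | (pair_val p).1 = (pair_val p).2])).
have key (Y : finType) (t : term S (unit + Y)) (r : Y -> pair_alg kappa)
    (p q : pair_alg kappa) a b : psi a b -> pair_val p = (a, a) ->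
    pair_val q = (b, b) ->
    [set p | (pair_val p).1 = (pair_val p).2] (eval (blocks (fun=> p) r) t) ->
    [set p | (pair_val p).1 = (pair_val p).2] (eval (blocks (fun=> q) r) t).
  move=> ab pa qb /=.
  rewrite !(hom_blocks _ _ _ (fst_hom (kappa := kappa))).
  rewrite !(hom_blocks _ _ _ (snd_hom (kappa := kappa))) /comp /= pa qb /=.
  apply: (centralizes_fin C) => // j; exact: (svalP (r j)).
move=> Y t r p q [a [b [ab pa qb]]]; split; first exact: key ab _ _.
exact: key (con_sym ab) _ _.
Qed.

Lemma Delta_gen (S : signature) (B : algebra S) (kappa psi : con B) (a b : B)
    (p q : pair_alg kappa) :
  psi a b -> pair_val p = (a, a) -> pair_val q = (b, b) -> Delta kappa psi p q.
Proof. by move=> ab pa qb chi; apply; exists a, b. Qed.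

(** By [Delta_diag] the class of (c,c) contains diagonal pairs only, and the generators supply all
    those over the annihilator class of c; hence it is exactly a set 0_E. *)
Lemma transversalE (S : signature) (B : algebra S) (kappa : con B)
    (x : diff_alg kappa) :
  Defs.transversal kappa x <-> exists c, x = proj _ (mkpair (con_refl kappa c)).
Proof.
have E c : class_set (Delta kappa (annihilator kappa)) (mkpair (con_refl kappa c))
    = zero_set (proj (annihilator kappa) c).
  apply/seteqP; split=> p.
    move=> cp.
    have {}cp : Delta kappa (annihilator kappa) (mkpair (con_refl kappa c)) p := cp.
    exists (pair_val p).1; first exact: (Delta_le_bar cp).
    have := Delta_diag (fun _ _ => id) cp erefl.
    by case: (pair_val p) => ? ? /= ->.
  by move=> [b cb pb]; apply: Delta_gen cb _ pb.
split=> [[X xX]|[c ->]].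
  have [c cX] := proj_surj X; exists c; subst X.
  by apply: quot_eq; rewrite xX -E.
by exists (proj _ c); rewrite -E.
Qed.

Lemma derived_conE (S : signature) (B : algebra S) (kappa : con B)
    (p q : pair_alg kappa) :
  derived_con kappa (proj _ p) (proj _ q) <->
  annihilator kappa (pair_val p).1 (pair_val q).1.
Proof. by apply: quot_conE; apply: Delta_le_bar. Qed.

Lemma pair_classE (S : signature) (B : algebra S) (kappa psi : con B)
    (u v : B) (uv : kappa u v) :
  pair_class kappa psi u v = class_set (Delta kappa psi) (mkpair uv).
Proof.
apply/seteqP; split=> p; last by move=> h; exists (mkpair uv).
move=> [q [qE qp]].
suff -> : mkpair uv = q by [].
by apply: pair_alg_eq; rewrite qE.
Qed.

(** * The difference term modulo Delta *)

Lemma centralizes_eval3 (S : signature) (A : algebra S)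
    (phi theta delta : con A) (d : term S 'I_3) (x y u v u' v' : A) :
  centralizes phi theta delta -> theta x y -> phi u u' -> phi v v' ->
  delta (eval3 d x u v) (eval3 d y u v) ->
  delta (eval3 d x u' v') (eval3 d y u' v').
Proof.
move=> C xy uu vv.
(* The first variable of [d] forms the [theta] block; the other two, indexed by [bool], form the
   [phi] block. *)
pose s (i : 'I_3) : term S (bool + unit) :=
  tnth [tuple Var (inr tt); Var (inl true); Var (inl false)] i.
have E z w w' : eval3 d z w w' =
    eval (blocks (fun b => if b then w else w') (fun=> z)) (subst s d).
  rewrite eval_subst /eval3; congr (eval _ d).
  by apply/funext => -[[|[|[|i]]] hi].
by rewrite !E; apply: (centralizes_fin C) => // -[].
Qed.

Lemma wdt_abelian (S : signature) (V : algebra S -> Prop) (d : term S 'I_3)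
    (B : algebra S) (kappa : con B) (a b : B) :
  weak_difference_term V d -> V B -> abelian kappa (con0 B) -> kappa a b ->
  eval3 d a a b = b /\ eval3 d b a a = b.
Proof.
move=> [_ wd] VB ab_kappa ab.
have le0 : con_le (con0 B) kappa by move=> x _ <-; apply: con_refl.
by have [/= -> <-] := wd B VB _ _ le0 ab_kappa _ _ ab.
Qed.

Lemma Delta_fst_inj (S : signature) (V : algebra S -> Prop) (d : term S 'I_3)
    (B : algebra S) (kappa : con B) (p q : pair_alg kappa) :
  weak_difference_term V d -> V B -> abelian kappa (con0 B) ->
  Delta kappa (annihilator kappa) p q -> (pair_val p).1 = (pair_val q).1 ->
  p = q.
Proof.
move=> wd VB ab_kappa pq pq1; apply: pair_alg_eq => //; have wda := wdt_abelian wd VB ab_kappa.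
have pP : kappa (pair_val p).1 (pair_val p).2 := svalP p.
have qP : kappa (pair_val q).1 (pair_val q).2 := svalP q.
pose o : pair_alg kappa := mkpair (con_refl kappa (pair_val p).1).
(* With p = (a,a') and q = (a,b'), the pair d(p,p,o) = (a,a) is diagonal, hence so is d(q,p,o),
   which says d(b',a',a) = a. *)
have := Delta_diag (fun _ _ => id)
  (eval3_con d pq (con_refl _ p) (con_refl _ o)).
rewrite !(eval3_hom _ _ _ _ (fst_hom (kappa := kappa))).
rewrite !(eval3_hom _ _ _ _ (snd_hom (kappa := kappa))) /= -pq1.
move: (pair_val p).1 (pair_val p).2 (pair_val q).2 pP qP pq1 => a a' b' aa' + pq1.
rewrite -pq1 => ab'.
have [-> _] := wda _ _ (con_refl kappa a).
have [-> _] := wda _ _ (con_sym aa').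
move=> /(_ erefl) ad.
have b'a' : kappa b' a' by exact: con_trans (con_sym ab') aa'.
(* Since also d(a',a',a) = a, the term condition for [kappa] lets the last argument change from a to
   a', leaving b' = a'. *)
have : con0 B (eval3 d b' a' a') (eval3 d a' a' a').
  apply: (centralizes_eval3 ab_kappa b'a' (con_refl _ _) aa').
  by rewrite /= -ad; have [-> _] := wda _ _ (con_sym aa').
move=> /=; have [-> _] := wda _ _ (con_refl kappa a').
by have [_ ->] := wda _ _ (con_sym b'a').
Qed.

Lemma pair_alg_wdt (S : signature) (V : algebra S -> Prop) (d : term S 'I_3)
    (B : algebra S) (kappa : con B) (p : pair_alg kappa) :
  weak_difference_term V d -> V B -> abelian kappa (con0 B) ->
  let o := mkpair (con_refl kappa (pair_val p).1) in
  eval3 d o o p = p /\ eval3 d p o o = p.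
Proof.
move=> wd VB ab_kappa; have wda := wdt_abelian wd VB ab_kappa.
have [d1l d1r] := wda _ _ (con_refl kappa (pair_val p).1).
have [d2l d2r] := wda _ _ (svalP p).
split; apply: pair_alg_eq;
  by rewrite !(eval3_hom _ _ _ _ (fst_hom (kappa := kappa)),
               eval3_hom _ _ _ _ (snd_hom (kappa := kappa))).
Qed.

(** Let [eta] be the kernel of the first coordinate. On [eta], Delta is equality by [Delta_fst_inj],
    so C(eta,eta;Delta) follows from [kappa] being abelian in the second coordinate. Then [eta] is
    enlarged to bar, first on the left and then on the right. *)
Lemma abelian_bar_con (S : signature) (V : algebra S -> Prop) (d : term S 'I_3)
    (B : algebra S) (kappa : con B) :
  weak_difference_term V d -> V B -> abelian kappa (con0 B) ->
  abelian (bar_con kappa (annihilator kappa)) (Delta kappa (annihilator kappa)).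
Proof.
move=> wd VB ab_kappa; have wda := wdt_abelian wd VB ab_kappa.
set beta := annihilator kappa; set Dl := Delta kappa beta.
pose eta := con_preim (fst_hom (kappa := kappa)) (con0 B).
pose o a : pair_alg kappa := mkpair (con_refl kappa a).
have oo a b : beta a b -> Dl (o a) (o b) by move=> ab; apply: Delta_gen ab _ _.
have C1 : centralizes eta eta Dl.
  apply: (@centralizes_meet _ _ _ _ (con0 _)) => [p q pq|m n t a b c e ab ce].
    split=> [->|h]; [exact: con_refl|exact: (Delta_fst_inj wd VB ab_kappa h pq)].
  have eta_snd (p q : pair_alg kappa) :
      eta p q -> kappa (pair_val p).2 (pair_val q).2.
    move=> pq; apply: con_trans (con_sym (svalP p)) _.
    by rewrite -[(sval p).1]/((pair_val p).1) pq; apply: (svalP q).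
  move=> /= tac; apply: pair_alg_eq.
    rewrite !(hom_blocks _ _ _ (fst_hom (kappa := kappa))).
    by congr (eval (blocks _ _) t); apply/funext => i /=; apply: ce.
  rewrite !(hom_blocks _ _ _ (snd_hom (kappa := kappa))).
  apply: (ab_kappa _ _ _ (fun i => (pair_val (a i)).2)) => [i|i|/=].
  - exact: eta_snd.
  - exact: eta_snd.
  - by rewrite -!(hom_blocks _ _ _ (snd_hom (kappa := kappa))) tac.
have {}C1 : centralizes (bar_con kappa beta) eta Dl.
  apply/le_residual => p q pq.
  have le1 : con_le eta (residual Dl eta) by apply/le_residual.
  have le2 : con_le Dl (residual Dl eta) by apply/le_residual/centralizes_le.
  (* A bar-pair is an [eta]-step to the diagonal, a Delta-step along it and an [eta]-step back. *)
  apply: (@con_trans _ _ _ _ (o (pair_val p).1)); first exact: le1.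
  apply: (@con_trans _ _ _ _ (o (pair_val q).1)); first exact/le2/oo.
  exact: le1.
(* Both pairs move, along Delta, over the common first coordinate d(a,a,b). *)
apply: centralizes_compose C1 => p q pq.
set a := (pair_val p).1; set b := (pair_val q).1.
exists (eval3 d p (o a) (o b)), (eval3 d (o a) (o a) q); split.
- rewrite -{1}(pair_alg_wdt p wd VB ab_kappa).2 -/a.
  by apply: eval3_con (con_refl _ _) (con_refl _ _) _; apply: oo.
- by rewrite /= !(eval3_hom _ _ _ _ (fst_hom (kappa := kappa))).
- rewrite -[X in Dl _ X](pair_alg_wdt q wd VB ab_kappa).1 -/b.
  by apply: eval3_con (oo _ _ pq) (oo _ _ pq) (con_refl _ _).
Qed.

(* For K-related p, q and o the diagonal pair on the first coordinate of p,
   d(q,p,o) is K-related to o, hence diagonal, hence Delta-related to o and to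
   d(p,p,o); as bar/Delta is abelian, d(q,p,p) and d(p,p,p) are then also
   Delta-related. *)
Lemma le_Delta (S : signature) (V : algebra S -> Prop) (d : term S 'I_3)
    (B : algebra S) (kappa : con B) (K : con (pair_alg kappa)) :
  variety V -> weak_difference_term V d -> V B -> abelian kappa (con0 B) ->
  con_le (Delta kappa (annihilator kappa)) K ->
  con_le K (bar_con kappa (annihilator kappa)) ->
  (forall p q : pair_alg kappa, K p q -> (pair_val p).1 = (pair_val p).2 ->
     (pair_val q).1 = (pair_val q).2) ->
  con_le K (Delta kappa (annihilator kappa)).
Proof.
move=> HV wd VB ab_kappa DK Kbar Kdiag p q pq.
have ab_bar := abelian_bar_con wd VB ab_kappa.
set beta := annihilator kappa in DK Kbar ab_bar *.
pose o a : pair_alg kappa := mkpair (con_refl kappa a).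
have oo a b : beta a b -> Delta kappa beta (o a) (o b).
  by move=> ab; apply: Delta_gen ab _ _.
have VP : V (pair_alg kappa) by exact: variety_pair_alg.
have wdb u v := wd.2 _ VP _ _ (@Delta_le_bar _ _ _ beta) ab_bar u v.
pose op := o (pair_val p).1.
have p_op : bar_con kappa beta p op by exact: con_refl.
have [ppo _] := wdb _ _ p_op.
pose r := eval3 d q p op.
have K_op_r : K op r.
  apply: con_trans (con_sym (DK _ _ ppo)) _.
  exact: eval3_con pq (con_refl _ _) (con_refl _ _).
have r_diag := Kdiag _ _ K_op_r erefl.
have op_r : Delta kappa beta op r.
  have -> : r = o (pair_val r).1 by exact: pair_alg_eq.
  exact/oo/(Kbar _ _ K_op_r).
have qp := con_sym (Kbar _ _ pq).
have h : Delta kappa beta (eval3 d q p p) (eval3 d p p p).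
  apply: (centralizes_eval3 ab_bar qp (con_refl _ _) (con_sym p_op)).
  exact: con_trans (con_sym op_r) (con_sym ppo).
have [_ qpp] := wdb _ _ (Kbar _ _ pq).
have [_ ppp] := wdb p p (con_refl _ _).
exact: con_trans ppp (con_trans (con_sym h) (con_sym qpp)).
Qed.

(** * Difference algebras *)

(** The map goes through representatives; one direction of the third hypothesis makes it independent
    of their choice, the other makes it injective. *)
Lemma quot_iso (S : signature) (P P' : algebra S) (F : P -> P')
    (Th : con P) (Th' : con P') :
  is_hom F -> (forall p', exists p, F p = p') ->
  (forall p q, Th p q <-> Th' (F p) (F q)) ->
  exists h : quot Th -> quot Th',
    isomorphism h /\ forall p, h (proj Th p) = proj Th' (F p).
Proof.
move=> FH Fsurj ThE; pose h (X : quot Th) := proj Th' (F (quot_repr X)).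
have hproj p : h (proj Th p) = proj Th' (F p).
  by apply/projP/ThE/projP; apply: quot_reprK.
exists h; split => //; split.
  move=> f X; pose x i := quot_repr (X i).
  have -> : X = fun i => proj Th (x i).
    by apply/funext => i; rewrite quot_reprK.
  rewrite -(proj_hom Th) hproj FH (proj_hom Th').
  by congr (op f _); apply/funext => i; rewrite hproj.
have /choice [g gK] Y : exists X, h X = Y.
  have [p' <-] := proj_surj Y; have [p <-] := Fsurj p'.
  by exists (proj Th p).
exists g => // X; have [p Xp] := proj_surj X; have [q gq] := proj_surj (g (h X)).
have := gK (h X); rewrite -gq -Xp !hproj => /projP /ThE qp.
by rewrite -/(proj Th q); apply/projP.
Qed.

Lemma isomorphism_inv (S : signature) (D D' : algebra S) (h : D -> D')
    (g : D' -> D) :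
  is_hom h -> cancel h g -> cancel g h -> is_hom g.
Proof.
move=> hh hK gK f x; apply: (can_inj hK); rewrite gK hh.
by congr (op f _); apply/funext => i; rewrite gK.
Qed.

(** These are all the data from which the division ring is built. The inverse is an explicit
    argument so that conjugation reads [h \o l \o g]. *)
Definition diff_iso (S : signature) (B B' : algebra S) (kappa : con B)
    (kappa' : con B') (h : diff_alg kappa -> diff_alg kappa')
    (g : diff_alg kappa' -> diff_alg kappa) : Prop :=
  [/\ is_hom h, cancel h g, cancel g h,
      forall x y, derived_con kappa x y <-> derived_con kappa' (h x) (h y)
    & forall x, Defs.transversal kappa x <-> Defs.transversal kappa' (h x)].

Lemma diff_iso_sym (S : signature) (B B' : algebra S) (kappa : con B)
    (kappa' : con B') (h : diff_alg kappa -> diff_alg kappa')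
    (g : diff_alg kappa' -> diff_alg kappa) :
  diff_iso h g -> diff_iso g h.
Proof.
move=> [hh hK gK hD hT]; split => //.
- exact: isomorphism_inv hh hK gK.
- by move=> x y; rewrite hD !gK.
- by move=> x; rewrite hT gK.
Qed.

Lemma F_set_conj (S : signature) (B B' : algebra S) (kappa : con B)
    (kappa' : con B') (h : diff_alg kappa -> diff_alg kappa')
    (g : diff_alg kappa' -> diff_alg kappa) l :
  diff_iso h g -> F_set kappa l -> F_set kappa' (h \o l \o g).
Proof.
move=> hg [lh ld lt]; have [gh _ _ _ _] := diff_iso_sym hg.
case: hg => hh hK gK hD hT; split.
- by move=> f x /=; rewrite gh lh hh.
- by move=> x y xy; apply/hD/ld/hD; rewrite !gK.
- by move=> x xT /=; rewrite lt ?gK //; apply/hT; rewrite gK.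
Qed.

Lemma retraction_conj (S : signature) (B B' : algebra S) (kappa : con B)
    (kappa' : con B') (h : diff_alg kappa -> diff_alg kappa')
    (g : diff_alg kappa' -> diff_alg kappa) r :
  diff_iso h g ->
  retraction (Defs.transversal kappa) (derived_con kappa) r ->
  retraction (Defs.transversal kappa') (derived_con kappa') (h \o r \o g).
Proof.
move=> hg [rh rT rid rk]; have [gh _ _ gD _] := diff_iso_sym hg.
case: hg => hh hK gK hD hT; split.
- by move=> f x /=; rewrite gh rh hh.
- apply/seteqP; split=> [_ [x _ <-]|x xT] /=.
    by apply/hT; rewrite -rT; exists (g x).
  by exists x => //=; rewrite rid ?gK //; apply/hT; rewrite gK.
- by move=> x xT /=; rewrite rid ?gK //; apply/hT; rewrite gK.
- by move=> x y; rewrite gD -rk; split=> [/(can_inj hK)|/= ->].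
Qed.

Lemma F_zero_retraction (S : signature) (B : algebra S) (kappa : con B) r :
  retraction (Defs.transversal kappa) (derived_con kappa) r -> F_zero kappa = r.
Proof.
move=> rr; apply: retraction_unique (rr); rewrite /F_zero.
by case: xgetP => [r' _ //|/(_ r)] /(_ rr).
Qed.

(* If there is no retraction on either side, both zeros are the junk value
   [idfun] of [xget]. *)
Lemma F_zero_conj (S : signature) (B B' : algebra S) (kappa : con B)
    (kappa' : con B') (h : diff_alg kappa -> diff_alg kappa')
    (g : diff_alg kappa' -> diff_alg kappa) :
  diff_iso h g -> h \o F_zero kappa \o g = F_zero kappa'.
Proof.
move=> hg; have [[r rr]|nr] := pselect (exists r,
    retraction (Defs.transversal kappa) (derived_con kappa) r).
  by rewrite (F_zero_retraction rr) (F_zero_retraction (retraction_conj hg rr)).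
rewrite {1}/F_zero; case: xgetP => [r _ rr|_]; first by case: nr; exists r.
rewrite /F_zero; case: xgetP => [r _ rr|_].
  by case: nr; exists (g \o r \o h); apply: retraction_conj rr; apply: diff_iso_sym.
by apply/funext => x /=; case: hg.
Qed.

Lemma diff_iso_F_isomorphic (S : signature) (d : term S 'I_3)
    (B B' : algebra S) (kappa : con B) (kappa' : con B')
    (h : diff_alg kappa -> diff_alg kappa')
    (g : diff_alg kappa' -> diff_alg kappa) :
  diff_iso h g -> F_isomorphic d kappa kappa'.
Proof.
move=> hg; have gh := diff_iso_sym hg; have [hh hK gK _ _] := hg.
exists (fun l => h \o l \o g); split.
- split=> [l|l m _ _ lm|l ll].
  + exact: F_set_conj.
  + apply/funext => x; apply: (can_inj hK).
    by have := congr1 (fun l => l (h x)) lm; rewrite /= hK.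
  + exists (g \o l \o h); first exact: F_set_conj.
    by apply/funext => x /=; rewrite !gK.
- exact: F_zero_conj.
- exact/funext.
- move=> l m _ _; apply/funext => x.
  by rewrite /F_add /= eval3_hom // -(F_zero_conj hg).
- by move=> l m _ _; apply/funext => x; rewrite /F_mul /= hK.
Qed.

(** Applying [f] to both coordinates maps the pairs of [kappa] onto those of [kappa']; what remains
    is that the kernel [K] of the resulting map to the difference algebra of [kappa'] is Delta,
    which is [le_Delta]. *)
Lemma diff_alg_iso (S : signature) (V : algebra S -> Prop) (d : term S 'I_3)
    (B B' : algebra S) (f : B -> B') (kappa : con B) (kappa' : con B')
    (fkappa : forall x y, kappa x y -> kappa' (f x) (f y)) :
  variety V -> weak_difference_term V d -> V B -> abelian kappa (con0 B) ->
  is_hom f -> (forall b', exists b, f b = b') ->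
  (forall u v, kappa' u v -> exists x y, [/\ kappa x y, f x = u & f y = v]) ->
  (forall x y, kappa x y -> f x = f y -> x = y) ->
  (forall x y, annihilator kappa x y <-> annihilator kappa' (f x) (f y)) ->
  exists h g, [/\ @diff_iso S B B' kappa kappa' h g
    & forall x y (xy : kappa x y),
        h (proj _ (mkpair xy)) = proj _ (mkpair (fkappa _ _ xy))].
Proof.
move=> HV wd VB ab_kappa fh fsurj kappa_surj kappa_inj fann.
pose F (p : pair_alg kappa) : pair_alg kappa' := mkpair (fkappa _ _ (svalP p)).
have Fh : is_hom F by move=> s x; apply: pair_alg_eq; rewrite /= fh.
have Fsurj p' : exists p, F p = p'.
  have [x [y [xy xE yE]]] := kappa_surj _ _ (svalP p').
  by exists (mkpair xy); apply: pair_alg_eq.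
pose K := con_preim Fh (Delta kappa' (annihilator kappa')).
(* Generators go to generators, as the annihilators correspond. *)
have DK : con_le (Delta kappa (annihilator kappa)) K.
  move=> p q /(_ K); apply=> u v [a [b [ab ua vb]]].
  have F1 (p' : pair_alg kappa) c : pair_val p' = (c, c) -> pair_val (F p') = (f c, f c).
    by rewrite /pair_val /= => ->.
  by apply: Delta_gen (F1 _ _ ua) (F1 _ _ vb); apply/fann.
have KD : con_le K (Delta kappa (annihilator kappa)).
  apply: (le_Delta HV wd VB ab_kappa DK) => [p q pq|p q pq pE].
    by apply/fann; apply: (Delta_le_bar pq).
  (* The image of [q] is diagonal, and [f] is injective on [kappa]-classes, so [q] is diagonal. *)
  have := Delta_diag (fun _ _ => id) pq (congr1 f pE).
  by apply: kappa_inj; apply: (svalP q).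
have [h [[hh [g hK gK]] hproj]] :=
  @quot_iso _ _ _ F (Delta kappa (annihilator kappa))
    (Delta kappa' (annihilator kappa')) Fh Fsurj
    (fun p q => conj (DK p q) (KD p q)).
exists h, g; split; last first.
  by move=> x y xy; rewrite hproj; congr (proj _ _); apply: pair_alg_eq.
split => // [X Y|X].
  have [p <-] := proj_surj X; have [q <-] := proj_surj Y.
  by rewrite !hproj !derived_conE; apply: fann.
rewrite !transversalE; split=> [[c ->]|[c' hX]].
  by exists (f c); rewrite hproj; congr (proj _ _); apply: pair_alg_eq.
have [c cE] := fsurj c'; exists c; apply: (can_inj hK); rewrite hX hproj.
by congr (proj _ _); apply: pair_alg_eq.
Qed.

(** * Perspective quotients *)

(** The relation delta o theta o delta contains both congruences and is reflexive, symmetric and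
    compatible. Transitivity reduces to placing theta o delta o theta inside it, where [d] is
    used. *)
Lemma join_compose (S : signature) (V : algebra S -> Prop) (d : term S 'I_3)
    (A : algebra S) (gamma theta delta : con A) :
  weak_difference_term V d -> V A -> con_le gamma theta -> con_le gamma delta ->
  abelian theta gamma -> abelian (con_join theta delta) delta ->
  forall x y, con_join theta delta x y ->
    exists x' y', [/\ delta x x', theta x' y' & delta y' y].
Proof.
move=> [_ wd] VA gt gd ab_theta ab_join.
have td : con_le theta (con_join theta delta) by move=> x y xy psi; apply; left.
have dj : con_le delta (con_join theta delta) by move=> x y xy psi; apply; right.
have wdt := wd A VA _ _ gt ab_theta; have wdj := wd A VA _ _ dj ab_join.
pose R x y := exists x' y', [/\ delta x x', theta x' y' & delta y' y].
have Rrefl x : R x x by exists x, x; split; apply: con_refl.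
have Rsym x y : R x y -> R y x.
  by move=> [x' [y' [? ? ?]]]; exists y', x'; split; apply: con_sym.
(* The chain is a, d(a,b,b), d(a,b,c), d(b,b,e), e, with steps in [gamma], [delta], [theta],
   [delta]; the first uses that theta/gamma is abelian, the last that the join is abelian over
   [delta]. *)
have key a b c e : theta a b -> delta b c -> theta c e -> R a e.
  move=> ab bc ce; exists (eval3 d a b c), (eval3 d b b e); split.
  - apply: con_trans (eval3_con d (con_refl _ a) (con_refl _ b) bc).
    apply/gd; apply: con_trans (wdt _ _ (con_sym ab)).2 _; exact: con_refl.
  - exact: eval3_con ab (con_refl _ _) ce.
  - by apply: (wdj b e _).1; apply: con_trans (dj _ _ bc) (td _ _ ce).
have Rtrans x y z : R x y -> R y z -> R x z.
  move=> [x' [y' [xx xy yy]]] [y2 [z' [yy2 yz zz]]].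
  have [u [v [xu uv vz]]] := key _ _ _ _ xy (con_trans yy yy2) yz.
  by exists u, v; split; [apply: con_trans xx xu| |apply: con_trans vz zz].
have Rop (f : symbol S) (x y : 'I_(arity f) -> A) :
    (forall i, R (x i) (y i)) -> R (op f x) (op f y).
  move=> xy.
  have /choice [w hw] i : exists p : A * A,
      [/\ delta (x i) p.1, theta p.1 p.2 & delta p.2 (y i)].
    by have [x' [y' ?]] := xy i; exists (x', y').
  exists (op f (fun i => (w i).1)), (op f (fun i => (w i).2)).
  by split; apply: con_op => i; case: (hw i).
move=> x y /(_ (Con Rrefl Rsym Rtrans Rop)); apply=> u v [uv|uv].
  by exists u, v; split => //; apply: con_refl.
by exists v, v; split => //; apply: con_refl.
Qed.

Theorem theorem6p10 (S : signature) (V : algebra S -> Prop) (d : term S 'I_3)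
    (A : algebra S) (gamma theta delta epsilon alpha : con A) :
  variety V -> weak_difference_term V d -> V A ->
  covers gamma theta -> covers delta epsilon ->
  abelian theta gamma -> abelian epsilon delta ->
  con_meet theta delta = gamma -> con_join theta delta = epsilon ->
  alpha = residual gamma theta ->
  (exists h : diff_alg (quot_con gamma theta) -> diff_alg (quot_con delta epsilon),
     isomorphism h /\
     forall a b : A, theta a b ->
       exists2 x : diff_alg (quot_con gamma theta),
         sval x = pair_class (quot_con gamma theta) (quot_con gamma alpha)
                    (proj gamma a) (proj gamma b)
       & sval (h x) = pair_class (quot_con delta epsilon) (quot_con delta alpha)
                    (proj delta a) (proj delta b)) /\
  F_isomorphic d (quot_con gamma theta) (quot_con delta epsilon).
Proof.
move=> HV wd VA [[gt _] _] [[de _] _] ab_theta ab_eps meetE joinE alphaE.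
have gd : con_le gamma delta by rewrite -meetE => x y [].
have te : con_le theta epsilon by rewrite -joinE => x y xy psi; apply; left.
have meetP x y : theta x y -> gamma x y <-> delta x y.
  by move=> xy; rewrite -meetE; split=> [[]|].
have split_eps x y : epsilon x y ->
    exists x' y', [/\ delta x x', theta x' y' & delta y' y].
  rewrite -joinE; apply: (join_compose wd VA gt gd ab_theta); by rewrite joinE.
(* Forwards, [gamma] becomes [delta], with which it agrees on [theta], and [theta] grows to delta o
   theta o delta. Backwards, [epsilon] is restricted to [theta]. Hence both residuals are
   [alpha]. *)
have CE phi : centralizes phi theta gamma <-> centralizes phi epsilon delta.
  split=> [C|C].
    exact/(centralizes_compose split_eps)/(centralizes_meet meetP).
  apply: (@centralizes_meet _ _ _ _ delta) => [x y /meetP -> //|].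
  move=> m n t a b c e ab ce; apply: C => // j; exact: te.
have alphaE' : alpha = residual delta epsilon.
  apply: con_eq => x y; split.
    move: x y; apply/le_residual/CE/le_residual; rewrite alphaE => x y //.
  by rewrite alphaE; move: x y; apply/le_residual/CE/le_residual => x y.
have ga : con_le gamma alpha.
  by rewrite alphaE; apply/le_residual/centralizes_le.
have da : con_le delta alpha.
  by rewrite alphaE'; apply/le_residual/centralizes_le.
have annE := annihilator_quot gt; rewrite -alphaE in annE.
have annE' := annihilator_quot de; rewrite -alphaE' in annE'.
(* The canonical map A/gamma -> A/delta; the choice of representative is harmless as gamma <=
   delta. *)
pose f (X : quot gamma) : quot delta := proj delta (quot_repr X).
have fproj a : f (proj gamma a) = proj delta a.
  by apply/projP/gd/projP; rewrite quot_reprK.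
have fh : is_hom f.
  move=> s X; pose x i := quot_repr (X i).
  have -> : X = fun i => proj gamma (x i).
    by apply/funext => i; rewrite quot_reprK.
  rewrite -(proj_hom gamma) fproj (proj_hom delta).
  by congr (op s _); apply/funext => i; rewrite fproj.
have fkappa x y : quot_con gamma theta x y -> quot_con delta epsilon (f x) (f y).
  have [a <-] := proj_surj x; have [b <-] := proj_surj y.
  by rewrite !fproj => /(quot_conE gt) /te /(quot_conE de).
have VB : V (quot gamma) := variety_surj HV (proj_hom gamma) (@proj_surj _ _ gamma) VA.
have ab_kappa : abelian (quot_con gamma theta) (con0 (quot gamma)).
  by apply/(centralizes_quot _ gt); rewrite preim_quot_con.
have [|||x y|h [g [hg hproj]]] :=
    diff_alg_iso fkappa HV wd VB ab_kappa fh.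
- by move=> Y; have [a <-] := proj_surj Y; exists (proj gamma a).
- move=> u v; have [a <-] := proj_surj u; have [b <-] := proj_surj v.
  (* The decomposition of [epsilon] provides a [theta]-pair with the same [delta]-classes. *)
  move=> /(quot_conE de) /split_eps [a' [b' [aa ab bb]]].
  exists (proj gamma a'), (proj gamma b'); rewrite !fproj; split.
  + exact/(quot_conE gt).
  + exact/projP/con_sym.
  + exact/projP.
- move=> x y; have [a <-] := proj_surj x; have [b <-] := proj_surj y.
  (* Injectivity on the classes of theta/gamma is theta /\ delta = gamma. *)
  by rewrite !fproj => /(quot_conE gt) ab /projP /(meetP _ _ ab) /projP.
- have [a <-] := proj_surj x; have [b <-] := proj_surj y.
  by rewrite !fproj annE annE' (quot_conE ga) (quot_conE da).
split; last exact: diff_iso_F_isomorphic hg.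
exists h; split; first by case: hg => hh hK gK _ _; split => //; exists g.
move=> a b /(quot_conE gt) ab; exists (proj _ (mkpair ab)).
  by rewrite (pair_classE _ ab) annE.
rewrite hproj -annE' -!fproj; exact/esym/pair_classE.
Qed.
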